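(* Let $A$ be a monomial Weil algebra. Then the subalgebra $SA$ of fixed points of $A$ is trivial, i.e. $SA=\mathbb{R}$.
   Context: A Weil algebra is a local commutative $\mathbb{R}$-algebra $A$ with identity whose nilradical (ideal of nilpotent elements) $\mathfrak{n}_A$ has finite dimension as a real vector space and satisfies $A/\mathfrak{n}_A=\mathbb{R}$. Its order $\mathrm{ord}(A)$ is the minimal integer $r$ with $\mathfrak{n}_A^{r+1}=0$, and its width is $\mathrm{w}(A)=\dim_{\mathbb{R}}(\mathfrak{n}_A/\mathfrak{n}_A^2)$. Let $\mathfrak{m}=\langle x_1,\dots,x_k\rangle\subset\mathbb{R}[x_1,\dots,x_k]$ and $\mathbb{D}^r_k=\mathbb{R}[x_1,\dots,x_k]/\mathfrak{m}^{r+1}$. Every Weil algebra $A$ of order $r$ and width $k$ can be expressed as $A=\mathbb{D}^r_k/\mathfrak{i}$, where $\mathfrak{i}$ is an ideal of $\mathbb{D}^r_k$ contained in the square of the maximal ideal of $\mathbb{D}^r_k$; Weil algebras are considered in this form. The Weil algebra $A=\mathbb{D}^r_k/\mathfrak{i}$ is called monomial if $\mathfrak{i}$ is a monomial ideal, i.e. generated by (classes of) monomials in $x_1,\dots,x_k$. $\mathrm{Aut}\,A$ denotes the group of $\mathbb{R}$-algebra automorphisms of $A$, and $SA=\{a\in A;\ \phi(a)=a\text{ for all }\phi\in\mathrm{Aut}\,A\}$ is the subalgebra of fixed points of $A$. It always contains the constants $\mathbb{R}=\mathbb{R}\cdot 1$; it is called trivial if $SA=\mathbb{R}$. *)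

(* Defs.v *)
From HB Require Import structures.
From mathcomp Require Import all_boot all_order all_algebra.
From mathcomp Require Import generic_quotient ring_quotient.
From mathcomp Require Import boolp classical_sets reals.
From mathcomp Require Import mpoly.

Set Implicit Arguments.
Unset Strict Implicit.
Unset Printing Implicit Defensive.

Import GRing.Theory.

Local Open Scope ring_scope.
Local Open Scope quotient_scope.
Local Open Scope classical_set_scope.

(* The library makes [{ideal_quot I}] a commutative ring only; for an ideal I of
   an R-algebra it is an R-algebra. *)
Section QuotientAlgebra.
Variables (R : nzRingType) (A : comAlgType R) (I : idealr A).
Local Notation Q := {ideal_quot I}.

Definition quot_scale (c : R) (q : Q) : Q := \pi_Q (c%:A) * q.

Lemma quot_scalerA c d q :
  quot_scale c (quot_scale d q) = quot_scale (c * d) q.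
Proof.
by rewrite /quot_scale mulrA -rmorphM /= -scalerAl mul1r scalerA.
Qed.

Lemma quot_scale1r : left_id 1 quot_scale.
Proof. by move=> q; rewrite /quot_scale scale1r rmorph1 mul1r. Qed.

Lemma quot_scalerDr : right_distributive quot_scale +%R.
Proof. by move=> c p q; rewrite /quot_scale mulrDr. Qed.

Lemma quot_scalerDl q : {morph quot_scale^~ q : c d / c + d}.
Proof. by move=> c d; rewrite /quot_scale scalerDl rmorphD mulrDl. Qed.

Lemma quot_scalerAl c p q : quot_scale c (p * q) = quot_scale c p * q.
Proof. by rewrite /quot_scale mulrA. Qed.

HB.instance Definition _ := GRing.Zmodule_isLmodule.Build R Q
  quot_scalerA quot_scale1r quot_scalerDr quot_scalerDl.
HB.instance Definition _ := GRing.Lmodule_isLalgebra.Build R Q quot_scalerAl.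
HB.instance Definition _ := GRing.Lalgebra_isComAlgebra.Build R Q.

Lemma pi_scalable : scalable (\pi_Q : A -> Q).
Proof.
by move=> c a; rewrite -[in LHS](mul1r a) scalerAl rmorphM.
Qed.
HB.instance Definition _ := GRing.isScalable.Build R A Q *:%R \pi_Q pi_scalable.

End QuotientAlgebra.

Section Ideals.
Variable A : comNzRingType.

Definition ideal_gen (S : set A) : set A :=
  [set a | exists2 s : seq (A * A),
     (forall bs, bs \in s -> S bs.2) & a = \sum_(bs <- s) bs.1 * bs.2].

Definition ideal_pow (I : set A) (n : nat) : set A :=
  ideal_gen [set \prod_(i < n) f i | f in [set f : 'I_n -> A | forall i, I (f i)]].

(* The elements of [idealr A] are the proper ideals of [A]. *)
Definition maximal_ideal (M : idealr A) : Prop :=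
  forall J : idealr A, {subset M <= J} -> J =i M.

Definition local_ring : Prop :=
  exists2 M : idealr A, maximal_ideal M & forall N : idealr A, maximal_ideal N -> N =i M.

Definition nilradical : {pred A} := [pred a | `[< exists n, a ^+ n = 0 >]].

Lemma nilradical_closed : idealr_closed nilradical.
Proof.
split.
- by apply/asboolP; exists 1%N; rewrite expr1.
- apply/asboolP => -[n]; rewrite expr1n => /eqP; by rewrite oner_eq0.
move=> a u v /asboolP [n un] /asboolP [m vm]; apply/asboolP.
exists (n + m)%N; rewrite exprDn big1 // => i _.
have [le_mi|lt_im] := leqP m i.
  by rewrite -(subnK le_mi) exprD vm !mulr0 mul0rn.
have /subnK <- : (n <= n + m - i)%N by rewrite -addnBA ?leq_addr // ltnW.
by rewrite exprMn [u ^+ _]exprD un !mulr0 mul0r mul0rn.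
Qed.
HB.instance Definition _ := isIdealr.Build A nilradical nilradical_closed.

Lemma ideal_gen0 S : ideal_gen S 0.
Proof. by exists [::]; rewrite ?big_nil. Qed.

Lemma ideal_genMD S a u v : ideal_gen S u -> ideal_gen S v -> ideal_gen S (a * u + v).
Proof.
move=> [s sS ->] [t tS ->]; exists ([seq (a * bs.1, bs.2) | bs <- s] ++ t).
  move=> bs; rewrite mem_cat => /orP[/mapP[cs /sS csS ->] //|]; exact: tS.
rewrite big_cat big_map /= mulr_sumr; congr (_ + _).
by apply: eq_bigr => bs _; rewrite mulrA.
Qed.

End Ideals.

Arguments nilradical A : clear implicits.

Section WeilAlgebras.
Variable R : realType.

(* dim (U / W) = d for subspaces W <= U of V: the classes of the e_i form a basis of U / W. *)
Definition quot_dim (V : lmodType R) (U W : set V) (d : nat) : Prop :=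
  exists e : 'I_d -> V, (forall i, U (e i)) /\
    forall u, U u -> exists! c : 'rV[R]_d, W (u - \sum_i c 0 i *: e i).

Definition alg_iso (A B : comAlgType R) : Prop :=
  exists f : {lrmorphism A -> B}, bijective f.

Definition weil_algebra (A : comAlgType R) : Prop :=
  [/\ local_ring A,
      exists d, quot_dim [set` nilradical A] [set 0] d
    & alg_iso {ideal_quot (nilradical A)} R^o].

Definition weil_order (A : comAlgType R) (r : nat) : Prop :=
  ideal_pow [set` nilradical A] r.+1 = [set 0] /\
  forall s, ideal_pow [set` nilradical A] s.+1 = [set 0] -> (r <= s)%N.

Definition weil_width (A : comAlgType R) (k : nat) : Prop :=
  quot_dim [set` nilradical A] (ideal_pow [set` nilradical A] 2) k.

Definition var_ideal (k : nat) : set {mpoly R[k]} :=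
  ideal_gen [set 'X_i | i in [set: 'I_k]].

Definition jet_ideal (k r : nat) : {pred {mpoly R[k]}} :=
  [pred p | `[< ideal_pow (@var_ideal k) r.+1 p >]].

Lemma jet_ideal_closed k r : idealr_closed (@jet_ideal k r).
Proof.
split.
- by apply/asboolP; exact: ideal_gen0.
- apply/asboolP => -[s sP] /(congr1 (meval (fun=> 0))).
  rewrite rmorph1 rmorph_sum /= big_seq big1 => [/eqP|]; first by rewrite oner_eq0.
  move=> bs bss.
  have [f fm <-] := sP _ bss; rewrite rmorphM rmorph_prod /= big_ord_recl.
  suff -> : meval (fun=> 0) (f ord0) = 0 by rewrite mul0r mulr0.
  have [t tX ->] := fm ord0; rewrite rmorph_sum /= big_seq big1 // => cs cst.
  by have [i _ <-] := tX _ cst; rewrite rmorphM /= mevalXU mulr0.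
move=> a u v /asboolP uI /asboolP vI; apply/asboolP; exact: ideal_genMD.
Qed.
HB.instance Definition _ k r :=
  isIdealr.Build {mpoly R[k]} (@jet_ideal k r) (jet_ideal_closed k r).

(* D^r_k = R[x_1, ..., x_k] / m^(r+1), with m = <x_1, ..., x_k>. *)
Definition jet_alg (k r : nat) := {ideal_quot (@jet_ideal k r)}.
HB.instance Definition _ k r := GRing.ComAlgebra.on (jet_alg k r).

Definition jet_class (k r : nat) (p : {mpoly R[k]}) : jet_alg k r :=
  \pi_{ideal_quot (@jet_ideal k r)} p.

Definition monomial_ideal (k r : nat) (i : idealr (jet_alg k r)) : Prop :=
  exists G : set 'X_{1..k}, [set` i] = ideal_gen [set jet_class r 'X_[m] | m in G].

(* A is isomorphic to D^r_k / i with r = ord A, k = w(A) and i a monomial ideal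
   contained in the square of the maximal ideal of D^r_k. *)
Definition monomial_weil_algebra (A : comAlgType R) : Prop :=
  weil_algebra A /\
  exists r k (i : idealr (jet_alg k r)),
    [/\ weil_order A r, weil_width A k,
        exists2 M : idealr (jet_alg k r),
          maximal_ideal M & [set` i] `<=` ideal_pow [set` M] 2,
        monomial_ideal i
      & alg_iso {ideal_quot i} A].

Definition fixed_points (A : comAlgType R) : set A :=
  [set a | forall f : {lrmorphism A -> A}, bijective f -> f a = a].

End WeilAlgebras.

Arguments fixed_points {R} A.

(* Main.v *)
Require Import Defs.
From HB Require Import structures.
From mathcomp Require Import all_boot all_order all_algebra.
From mathcomp Require Import generic_quotient ring_quotient.
From mathcomp Require Import boolp classical_sets reals.
From mathcomp Require Import mpoly.

(** Let m be the ideal of the variables.  Monomials are eigenvectors of the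
    dilations x_i |-> c x_i, with eigenvalue c^d in degree d.  Hence a dilation
    of the polynomial ring preserves every ideal generated by monomials, as well
    as m^(r+1), and it descends to an endomorphism of A
    (quotient_endomorphism, fixed_points_monomial_quotient); for c = 2 this
    endomorphism is an automorphism f, inverted by the dilation of ratio 1/2.

    That single automorphism has only the constants as fixed points
    (fixed_points_of_dilatable).  Let a be fixed, represented by a polynomial
    with constant term a_0.  Then b = a - a_0 is fixed too, and it lies in the
    image of m.  If b lies in the image of m^n with n > 0, then, since f acts as
    2^n on the image of m^n modulo that of m^(n+1), the element
    (1 - 2^n) b = f b - 2^n b lies in the image of m^(n+1), and so does b
    because 2^n <> 1.  Since m^(r+1) vanishes in A, b = 0. *)

Set Implicit Arguments.
Unset Strict Implicit.
Unset Printing Implicit Defensive.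

Import Order.TTheory GRing.Theory Num.Theory.

Local Open Scope ring_scope.
Local Open Scope classical_set_scope.

Lemma mem_ideal_gen (A : comNzRingType) (S : set A) (a : A) :
  S a -> ideal_gen S a.
Proof.
move=> Sa; exists [:: (1, a)]; last by rewrite big_seq1 mul1r.
by move=> bs; rewrite inE => /eqP ->.
Qed.

Lemma ideal_gen_mull (A : comNzRingType) (S : set A) (b a : A) :
  ideal_gen S a -> ideal_gen S (b * a).
Proof.
by move=> Sa; rewrite -[b * a]addr0; apply: ideal_genMD => //; exact: ideal_gen0.
Qed.

Lemma ideal_gen_sum (A : comNzRingType) (S : set A) (I : eqType) (s : seq I)
    (F : I -> A) :
  (forall j, j \in s -> ideal_gen S (F j)) -> ideal_gen S (\sum_(j <- s) F j).
Proof.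
move=> SF; rewrite big_seq; elim/big_ind: _ => //; first exact: ideal_gen0.
by move=> x y Sx Sy; rewrite -[x]mul1r; exact: ideal_genMD.
Qed.

Lemma ideal_gen_morph (A B : comNzRingType) (f : {rmorphism A -> B})
    (S : set A) (T : set B) (a : A) :
  (forall s, S s -> ideal_gen T (f s)) -> ideal_gen S a -> ideal_gen T (f a).
Proof.
move=> ST [s sS ->]; rewrite rmorph_sum; apply: ideal_gen_sum => bs bss.
by rewrite rmorphM; apply/ideal_gen_mull/ST/sS.
Qed.

Lemma ideal_pow_morph (A B : comNzRingType) (f : {rmorphism A -> B})
    (I : set A) (J : set B) (n : nat) (a : A) :
  (forall x, I x -> J (f x)) -> ideal_pow I n a -> ideal_pow J n (f a).
Proof.
move=> IJ; apply: ideal_gen_morph => _ [g gI <-].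
rewrite rmorph_prod; apply: mem_ideal_gen; exists (f \o g) => // i.
exact/IJ/gI.
Qed.

(** The usual factorization through a quotient, for a target presented as the
    image of a surjective morphism [q]. *)
Lemma quotient_endomorphism (R : nzRingType) (P A : comAlgType R)
    (q : {lrmorphism P -> A}) (f : {lrmorphism P -> P}) :
  (forall a, exists p, q p = a) -> (forall p, q p = 0 -> q (f p) = 0) ->
  exists g : {lrmorphism A -> A}, forall p, g (q p) = q (f p).
Proof.
move=> /choice[s sK] qf0; pose g a := q (f (s a)).
have gq p : g (q p) = q (f p).
  have : q (f (s (q p) - p)) = 0 by apply: qf0; rewrite rmorphB /= sK subrr.
  by rewrite !rmorphB => /eqP; rewrite subr_eq0 => /eqP.
have g_lin : linear g.
  move=> c a b; rewrite -[in LHS](sK a) -[in LHS](sK b) -linearP gq.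
  by rewrite !linearP.
have g_mul : monoid_morphism g.
  split=> [|a b]; first by rewrite -(rmorph1 q) gq !rmorph1.
  by rewrite -[in LHS](sK a) -[in LHS](sK b) -rmorphM gq !rmorphM.
pose gL := GRing.isLinear.Build R A A *:%R g g_lin.
pose gM := GRing.isMonoidMorphism.Build A A g g_mul.
pose G : {lrmorphism A -> A} := HB.pack g gL gM.
by exists G.
Qed.

(** The substitution x_i |-> c x_i. *)
Definition dilate (R : comNzRingType) (k : nat) (c : R) (p : {mpoly R[k]}) :
    {mpoly R[k]} :=
  p \mPo [tuple c *: 'X_i | i < k].

HB.instance Definition _ (R : comNzRingType) (k : nat) (c : R) :=
  GRing.LRMorphism.copy (@dilate R k c) (comp_mpoly [tuple c *: 'X_i | i < k]).

Lemma dilateX (R : comNzRingType) (k : nat) (c : R) (m : 'X_{1..k}) :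
  dilate c 'X_[m] = c ^+ mdeg m *: 'X_[m].
Proof.
rewrite /dilate comp_mpolyX.
under eq_bigr => i _ do rewrite tnth_mktuple exprZn.
by rewrite scaler_prod prodrXr -mdegE -mpolyXE_id.
Qed.

Lemma mcoeff_dilate (R : comNzRingType) (k : nat) (c : R) (p : {mpoly R[k]})
    (m : 'X_{1..k}) :
  (dilate c p)@_m = c ^+ mdeg m * p@_m.
Proof.
rewrite [in RHS](mpolyE p) {1}/dilate comp_mpolyEX.
rewrite !(raddf_sum (mcoeff m)) mulr_sumr.
apply: eq_bigr => u _ /=; rewrite !mcoeffZ.
rewrite -/(dilate c _) dilateX mcoeffZ mcoeffX.
by case: eqP => [->|_]; rewrite ?mulr0 // mulrCA.
Qed.

Lemma dilateK (R : fieldType) (k : nat) (c : R) :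
  c != 0 -> cancel (@dilate R k c) (dilate c^-1).
Proof.
move=> c0 p; apply/mpolyP => m; rewrite !mcoeff_dilate mulrA -exprMn.
by rewrite mulVf // expr1n mul1r.
Qed.

(** A monomial of degree at least n is a multiple of a product of n variables:
    split off one variable at a time. *)
Lemma mpolyX_pow_var_ideal (R : realType) (k n : nat) (m : 'X_{1..k}) :
  (n <= mdeg m)%N -> ideal_pow (@var_ideal R k) n 'X_[m].
Proof.
move=> le_nm.
suff [g [u ->]] : exists (g : 'I_n -> 'I_k) (u : {mpoly R[k]}),
    'X_[m] = u * \prod_(i < n) 'X_(g i).
  apply: ideal_gen_mull; apply: mem_ideal_gen; exists (fun i => 'X_(g i)) => // i.
  by apply: mem_ideal_gen; exists (g i).
elim: n m le_nm => [|n IHn] m le_nm.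
  have [g] : exists g : 'I_0 -> 'I_k, True by unshelve eexists; first by case.
  by exists g, 'X_[m]; rewrite big_ord0 mulr1.
have [j mj] : exists j, m j != 0%N.
  apply/existsP; apply: contraTT le_nm; rewrite negb_exists => /forallP m0.
  by rewrite mdegE big1 // => i _; apply/eqP; rewrite -[_ == _]negbK m0.
have le1m : (U_(j) <= m)%MM by rewrite lep1mP.
have [|g [u mE]] := IHn (m - U_(j))%MM.
  by move: le_nm; rewrite -{1}(submK le1m) mdegD mdeg1 addn1 ltnS.
exists (fun i => oapp g j (unlift ord0 i)), u.
rewrite big_ord_recl unlift_none /= mulrCA.
under eq_bigr => i _ do rewrite liftK /=.
by rewrite -mE -mpolyXD addmC submK.
Qed.

(** A dilation multiplies each variable by a constant, so it maps the ideal of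
    the variables, and then each of its powers, into itself. *)
Lemma jet_ideal_dilate (R : realType) (k r : nat) (c : R) (p : {mpoly R[k]}) :
  p \in @jet_ideal R k r -> dilate c p \in @jet_ideal R k r.
Proof.
move=> /asboolP pJ; apply/asboolP; move: pJ; apply: ideal_pow_morph => x.
apply: ideal_gen_morph => _ [i _ <-]; rewrite /= dilateX mdeg1 expr1 -mul_mpolyC.
by apply/ideal_gen_mull/mem_ideal_gen; exists i.
Qed.

Lemma idealquot_surj (P : comNzRingType) (I : idealr P) (a : {ideal_quot I}) :
  exists p, \pi_{ideal_quot I}%qT p = a.
Proof. by exists (repr a); rewrite reprK. Qed.

Lemma idealquot_eq0 (P : comNzRingType) (I : idealr P) (p : P) :
  (\pi_{ideal_quot I}%qT p = 0) <-> p \in I.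
Proof.
rewrite -[0](rmorph0 (\pi_{ideal_quot I}%qT)).
by split=> [/eqP|pI]; [|apply/eqP]; rewrite -Quotient.idealrBE subr0.
Qed.

(** The heart of the argument, for any quotient of the polynomial ring to which
    dilations descend and in which monomials of high degree vanish.  A fixed
    point minus its constant part is shown, by induction on n, to be represented
    by a polynomial [s] all of whose monomials have degree greater than n.  The
    inductive step replaces [s] by (1 - 2^(n+1))^-1 (s(2x) - 2^(n+1) s(x)), in
    which the coefficients of degree n + 1 cancel and which represents the same
    element because that element is fixed by the dilation of ratio 2. *)
Lemma fixed_points_of_dilatable (R : realType) (k r : nat) (A : comAlgType R)
    (q : {lrmorphism {mpoly R[k]} -> A}) :
  (forall a, exists p, q p = a) ->
  (forall c p, q p = 0 -> q (dilate c p) = 0) ->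
  (forall m, (r < mdeg m)%N -> q 'X_[m] = 0) ->
  fixed_points A = [set c%:A | c in [set: R]].
Proof.
move=> q_surj q_dilate q_nil; apply/seteqP; split=> [a fix_a|_ [c _ <-] f _].
  have induced c :=
    quotient_endomorphism (f := @dilate R k c) q_surj (q_dilate c).
  have [f fE] := induced 2; have [g gE] := induced 2^-1.
  have two0 : 2 != 0 :> R by rewrite pnatr_eq0.
  have f_bij : bijective f.
    exists g => b; have [p <-] := q_surj b; rewrite ?fE gE ?fE.
      by rewrite /= dilateK.
    by rewrite /= -{1}[2]invrK dilateK // invr_eq0.
  have [p pE] := q_surj a; exists p@_0%MM => //.
  suff /(_ r)[s sdeg sE] : forall n : nat, exists2 s : {mpoly R[k]},
      (forall m, m \in msupp s -> (n < mdeg m)%N) & a - (p@_0%MM)%:A = q s.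
    apply/esym/eqP; rewrite -subr_eq0 sE [s]mpolyE linear_sum big_seq big1 //.
    by move=> m /sdeg mr; rewrite linearZ /= q_nil // scaler0.
  elim=> [|n [s sdeg sE]].
    exists (p - (p@_0%MM)%:MP); last first.
      by rewrite rmorphB /= pE -[_%:MP]mulr1 mul_mpolyC rmorph_alg.
    move=> m; rewrite mcoeff_msupp mcoeffB mcoeffC lt0n mdeg_eq0.
    by have [->|//] := eqVneq m 0%MM; rewrite mulr1 subrr eqxx.
  have fs : q s = q (dilate 2 s).
    by rewrite -fE -sE rmorphB /= rmorph_alg fix_a.
  have pow0 : 1 - 2 ^+ n.+1 != 0 :> R.
    by rewrite subr_eq0 eq_sym gt_eqF // exprn_egt1 // ltr1n.
  exists ((1 - 2 ^+ n.+1)^-1 *: (dilate 2 s - 2 ^+ n.+1 *: s)).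
    move=> m; rewrite mcoeff_msupp mcoeffZ mcoeffB mcoeffZ mcoeff_dilate.
    rewrite -mulrBl; have [/sdeg|] := boolP (m \in msupp s); last first.
      by rewrite mcoeff_msupp negbK => /eqP ->; rewrite !mulr0 eqxx.
    by rewrite leq_eqVlt; case: eqP => // <-; rewrite subrr mul0r mulr0 eqxx.
  rewrite sE linearZ linearB linearZ /= -fs -{2}[q s]scale1r -scalerBl.
  by rewrite scalerA mulVf // scale1r.
exact: rmorph_alg.
Qed.

(** A dilation of D multiplies the class of a monomial by a constant, hence
    preserves every ideal generated by such classes: dilations pass to the
    quotient by a monomial ideal as soon as they pass to D. *)
Lemma fixed_points_monomial_quotient (R : realType) (k r : nat)
    (D A : comAlgType R) (pD : {lrmorphism {mpoly R[k]} -> D})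
    (I : idealr D) (G : set 'X_{1..k}) :
  (forall d, exists p, pD p = d) ->
  (forall c p, pD p = 0 -> pD (dilate c p) = 0) ->
  (forall m, (r < mdeg m)%N -> pD 'X_[m] = 0) ->
  [set` I] = ideal_gen [set pD 'X_[m] | m in G] ->
  alg_iso {ideal_quot I} A ->
  fixed_points A = [set c%:A | c in [set: R]].
Proof.
move=> pD_surj pD_dilate pD_nil IE [h [h' hK h'K]].
pose pI : {lrmorphism D -> {ideal_quot I}} := \pi_{ideal_quot I}%qT.
pose q : {lrmorphism {mpoly R[k]} -> A} := h \o (pI \o pD).
have q_ker p : q p = 0 <-> pD p \in I.
  rewrite -idealquot_eq0; split=> [q0|p0].
    by apply: (can_inj hK); rewrite rmorph0.
  by rewrite /q /= p0 rmorph0.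
have memI d : d \in I <-> ideal_gen [set pD 'X_[m] | m in G] d by rewrite -IE.
apply: (@fixed_points_of_dilatable _ k r _ q).
- move=> a; have [d dE] := idealquot_surj (h' a); have [p pE] := pD_surj d.
  by exists p; rewrite /q /= pE dE h'K.
- move=> c p /q_ker pI0; apply/q_ker.
  have [g gE] :=
    quotient_endomorphism (f := @dilate R k c) pD_surj (pD_dilate c).
  rewrite -gE; apply/memI; move: pI0 => /memI.
  apply: ideal_gen_morph => _ [m Gm <-]; rewrite /= gE /= dilateX linearZ /=.
  by rewrite -mulr_algl; apply/ideal_gen_mull/mem_ideal_gen; exists m.
- by move=> m /pD_nil p0; apply/q_ker; rewrite p0 rpred0.
Qed.

Theorem proposition1 (R : realType) (A : comAlgType R)
    (hA : monomial_weil_algebra A) :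
  fixed_points A = [set c%:A | c in [set: R]].
Proof.
case: hA => _ [r [k [I [_ _ _ [G IE] isoA]]]].
pose pD : {lrmorphism {mpoly R[k]} -> jet_alg R k r} :=
  \pi_{ideal_quot (@jet_ideal R k r)}%qT.
apply: (@fixed_points_monomial_quotient _ k r _ A pD I G) => //.
- exact: idealquot_surj.
- by move=> c p /idealquot_eq0 pJ; apply/idealquot_eq0/jet_ideal_dilate.
- by move=> m rm; apply/idealquot_eq0/asboolP/mpolyX_pow_var_ideal.
Qed.
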